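(* Let $k$ be a field, let $S=k[x_1,\ldots,x_n]$, let $\Delta$ be a matroid on the vertex set $[n]=\{1,\ldots,n\}$, and let $I=I_\Delta\subset S$ be its Stanley-Reisner ideal. Then $S/I^{(m)}$ is clean for every integer $m\geq 1$, where $I^{(m)}$ denotes the $m$-th symbolic power of $I$.
   Context: A simplicial complex $\Delta$ on $[n]$ is a collection of subsets of $[n]$ (called faces) closed under taking subsets; its maximal faces under inclusion are called facets. A matroid is a simplicial complex $\Delta$ such that for all faces $F,G\in\Delta$ with $|F|<|G|$ there exists $i\in G\setminus F$ with $F\cup\{i\}\in\Delta$. The Stanley-Reisner ideal of $\Delta$ is $I_\Delta=(\prod_{i\in F}x_i : F\subseteq[n],\ F\notin\Delta)\subset S$. For $F\subseteq [n]$ put $P_F=(x_i : i\in F)$. Then $I_\Delta=\bigcap_{G} P_{[n]\setminus G}$, where $G$ runs over the facets of $\Delta$, and the $m$-th symbolic power is $I_\Delta^{(m)}=\bigcap_{G} P_{[n]\setminus G}^m$, with $G$ again running over the facets of $\Delta$. For a monomial ideal $I\subset S$, a prime filtration of $S/I$ is a chain of monomial ideals $\mathcal F: I=I_0\subset I_1\subset\cdots\subset I_r=S$ such that for each $i=1,\ldots,r$ there is a monomial prime ideal $\mathfrak p_i$ of $S$ with $I_i/I_{i-1}\cong S/\mathfrak p_i$. Put $\operatorname{Supp}\mathcal F=\{\mathfrak p_1,\ldots,\mathfrak p_r\}$. The filtration is clean if $\operatorname{Supp}\mathcal F$ equals the set $\operatorname{Min} I$ of minimal primes of $I$. $S/I$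 is called clean if it admits a clean prime filtration. *)

(* Defs.v *)
From HB Require Import structures.
From mathcomp Require Import all_boot all_order all_algebra.
From mathcomp Require Import boolp classical_sets.
From mathcomp Require Import mpoly.

Set Implicit Arguments.
Unset Strict Implicit.
Unset Printing Implicit Defensive.

Import GRing.Theory.

Local Open Scope ring_scope.
Local Open Scope quotient_scope.
Local Open Scope classical_set_scope.

Section Ideals.
Variable R : comNzRingType.

(* Unlike mathcomp's [idealr], the unit ideal is allowed and membership is a
   proposition. *)
Definition is_ideal (I : set R) : Prop :=
  [/\ I 0, forall x y, I x -> I y -> I (x + y) & forall a x, I x -> I (a * x)].

Record ideal := Ideal { ideal_set :> set R; idealP : is_ideal ideal_set }.

Lemma unit_ideal_subproof : is_ideal setT.
Proof. by []. Qed.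
Definition unit_ideal := Ideal unit_ideal_subproof.

Lemma ideal_gen_subproof (A : set R) : is_ideal (smallest is_ideal A).
Proof.
split=> [I [[]] //|x y Ax Ay I [idI sAI]|a x Ax I [idI sAI]]; case: (idI) => _ D M.
- by apply: D; [apply: Ax | apply: Ay].
- by apply: M; apply: Ax.
Qed.
Definition ideal_gen (A : set R) := Ideal (ideal_gen_subproof A).

Lemma ideal_bigcap_subproof (T : Type) (D : set T) (F : T -> ideal) :
  is_ideal (\bigcap_(i in D) F i).
Proof.
split=> [i _|x y Fx Fy i Di|a x Fx i Di]; case: (idealP (F i)) => // _ H M.
- by apply: H; [apply: Fx | apply: Fy].
- by apply: M; apply: Fx.
Qed.
Definition ideal_bigcap (T : Type) (D : set T) (F : T -> ideal) :=
  Ideal (ideal_bigcap_subproof D F).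

Lemma ideal_sum (J : ideal) (T : eqType) (s : seq T) (f : T -> R) :
  (forall i, i \in s -> (J : set R) (f i)) -> (J : set R) (\sum_(i <- s) f i).
Proof.
case: (idealP J) => J0 JD _ Jf; rewrite big_seq.
by elim/big_ind: _.
Qed.

Definition ideal_pow (I : set R) (m : nat) : ideal :=
  ideal_gen [set x | exists2 f : 'I_m -> R,
                       forall i, I (f i) & x = \prod_(i < m) f i].

Definition is_prime_ideal (P : set R) : Prop :=
  [/\ is_ideal P, ~ P 1 & forall x y, P (x * y) -> P x \/ P y].

Definition min_primes (I : set R) : set (set R) :=
  [set P | [/\ is_prime_ideal P, I `<=` P &
     forall Q, is_prime_ideal Q -> I `<=` Q -> Q `<=` P -> Q = P]].

End Ideals.

Section IdealQuotient.
Variable R : comNzRingType.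
Implicit Types A B : ideal R.

Definition ideal_pred A : {pred R^o} := fun x => x \in (A : set R).

Lemma ideal_pred_submod_closed A : submod_closed (ideal_pred A).
Proof.
case: (idealP A) => A0 AD AM; split; first exact: mem_set.
by move=> a x y /set_mem Ax /set_mem Ay; apply/mem_set/AD => //; apply: AM.
Qed.
HB.instance Definition _ A :=
  GRing.isSubmodClosed.Build R R^o (ideal_pred A) (ideal_pred_submod_closed A).

Definition ideal_module A := {x : R^o | x \in ideal_pred A}.
HB.instance Definition _ A := SubChoice.on (ideal_module A).
HB.instance Definition _ A := [SubChoice_isSubLmodule of ideal_module A by <:].

(* A :&: B as a submodule of A. *)
Definition trace_pred A B : {pred ideal_module A} :=
  fun x => val x \in ideal_pred B.

Lemma trace_pred_submod_closed A B : submod_closed (@trace_pred A B).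
Proof.
split=> [|a x y Bx By]; first by rewrite unfold_in /= rpred0.
by rewrite unfold_in /= rpredD // rpredZ.
Qed.
HB.instance Definition _ A B := GRing.isSubmodClosed.Build R (ideal_module A)
  (@trace_pred A B) (trace_pred_submod_closed A B).

(* The quotient A / (A :&: B), as an R-module. *)
Definition ideal_quot A B := Quotient.quot (@trace_pred A B).
HB.instance Definition _ A B := ZmodQuotient.on (ideal_quot A B).

Section Scale.
Variables A B : ideal R.
Local Notation Q := (ideal_quot A B).

Definition quot_scale (a : R) (x : Q) : Q := \pi_Q (a *: repr x).

Lemma pi_scale a (x : ideal_module A) :
  quot_scale a (\pi_Q x) = \pi_Q (a *: x).
Proof.
rewrite /quot_scale; apply/eqP.
rewrite -(Quotient.idealrBE (@trace_pred A B)) -scalerBr rpredZ //.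
by rewrite (Quotient.idealrBE (@trace_pred A B)) reprK.
Qed.

Lemma quot_scaleA a b (x : Q) :
  quot_scale a (quot_scale b x) = quot_scale (a * b) x.
Proof. by elim/quotW: x => x; rewrite (pi_scale b x) !pi_scale scalerA. Qed.

Lemma quot_scale1 : left_id 1 quot_scale.
Proof. by elim/quotW => x; rewrite pi_scale scale1r. Qed.

Lemma quot_scaleDr : right_distributive quot_scale +%R.
Proof.
move=> a; elim/quotW => x; elim/quotW => y.
by rewrite !pi_scale -!raddfD /= !pi_scale scalerDr.
Qed.

Lemma quot_scaleDl (x : Q) : {morph quot_scale^~ x : a b / a + b}.
Proof.
by elim/quotW: x => x a b; rewrite !pi_scale scalerDl raddfD.
Qed.

HB.instance Definition _ := GRing.Zmodule_isLmodule.Build R Q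
  quot_scaleA quot_scale1 quot_scaleDr quot_scaleDl.
End Scale.

End IdealQuotient.

Definition module_iso (R : comNzRingType) (U V : lmodType R) : Prop :=
  exists f : {linear U -> V}, bijective f.

Section MonomialIdeals.
Variables (k : fieldType) (n : nat).
Local Notation S := {mpoly k[n]}.

Definition is_monomial_ideal (I : set S) : Prop :=
  exists A : set 'X_{1..n}, I = ideal_gen [set 'X_[u] | u in A].

(* The chain is I = F 0, ..., F r = S, and p i is the prime of the step from
   F i to F i.+1; the values of F above r and of p from r on are irrelevant. *)
Definition prime_filtration (I : set S) (r : nat) (F p : nat -> ideal S) : Prop :=
  [/\ F 0%N = I :> set S,
      F r = setT :> set S,
      forall i, (i <= r)%N -> is_monomial_ideal (F i),
      forall i, (i < r)%N -> F i `<` F i.+1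
    & forall i, (i < r)%N ->
        [/\ is_monomial_ideal (p i), is_prime_ideal (p i)
          & module_iso (ideal_quot (F i.+1) (F i))
                       (ideal_quot (unit_ideal S) (p i))]].

Definition filtration_supp (r : nat) (p : nat -> ideal S) : set (set S) :=
  [set (p i : set S) | i in [set i | (i < r)%N]].

(* This is cleanness of S/I. *)
Definition clean (I : set S) : Prop :=
  exists r F p, prime_filtration I r F p /\ filtration_supp r p = min_primes I.

Lemma mem_mpoly_ideal (J : ideal S) (f : S) :
  (forall u, u \in msupp f -> (J : set S) 'X_[u]) -> (J : set S) f.
Proof.
move=> Jf; rewrite [f]mpolyE; apply: ideal_sum => u /Jf Ju.
by case: (idealP J) => _ _ M; rewrite -mul_mpolyC; apply: M.
Qed.

Lemma msupp_div_ideal (P : set 'X_{1..n}) :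
  (forall u v, P u -> P (u + v)%MM) ->
  is_ideal [set f : S | forall u, u \in msupp f -> P u].
Proof.
move=> up; split=> [u|f g Pf Pg u|a f Pf u] /=; first by rewrite msupp0.
- by move/msuppD_le; rewrite mem_cat => /orP[/Pf|/Pg].
- by move/msuppM_le/allpairsP=> [[v w] /= [_ /Pf Pw ->]]; rewrite addmC; apply: up.
Qed.

End MonomialIdeals.

Section Complexes.
Variable n : nat.
Implicit Types (Delta : {set {set 'I_n}}) (F G : {set 'I_n}).

Definition simplicial_complex Delta : Prop :=
  forall F G, G \in Delta -> F \subset G -> F \in Delta.

Definition facet Delta G : Prop := maxset (mem Delta) G.

Definition matroid Delta : Prop :=
  simplicial_complex Delta /\
  forall F G, F \in Delta -> G \in Delta -> (#|F| < #|G|)%N ->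
    exists2 i, i \in G :\: F & i |: F \in Delta.

Variable k : fieldType.
Local Notation S := {mpoly k[n]}.

Definition var_ideal F : ideal S := ideal_gen [set 'X_i | i in [set` F]].

Definition stanley_reisner Delta : ideal S :=
  ideal_gen [set \prod_(i in F) 'X_i | F in [set F | F \notin Delta]].

Lemma var_idealP F f : (var_ideal F : set S) f <->
  (forall u, u \in msupp f -> exists2 i, i \in F & u i != 0%N).
Proof.
split=> [|Ff]; last first.
  apply: mem_mpoly_ideal => u /Ff [i Fi ui0].
  rewrite -(@submK _ U_(i) u) ?lep1mP // mpolyXD.
  by case: (idealP (var_ideal F)) => _ _; apply=> J [_]; apply; exists i.
move: f; apply: smallest_sub.
  apply: (@msupp_div_ideal k n [set u | exists2 i, i \in F & u i != 0%N]) => u v [i Fi ui].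
  by exists i => //; rewrite mnmDE addn_eq0 negb_and ui.
move=> _ [i Fi <-] u; rewrite msuppX inE => /eqP->.
by exists i => //; rewrite mnm1E eqxx.
Qed.

(* The facet decomposition of the Stanley-Reisner ideal, whose components are
   raised to the power m in [sr_symbolic_power] below. *)
Lemma stanley_reisnerE Delta : simplicial_complex Delta ->
  stanley_reisner Delta =
    \bigcap_(G in facet Delta) var_ideal (~: G) :> set S.
Proof.
move=> sD; apply/seteqP; split.
  apply: smallest_sub; first exact: (idealP (ideal_bigcap _ _)).
  move=> _ [F FD <-] G /maxsetP[DG _].
  have /subsetPn[i Fi Gi] : ~~ (F \subset G).
    by apply: contraNN (FD) => /sD; apply.
  rewrite (bigD1 i) //= mulrC.
  case: (idealP (var_ideal (~: G))) => _ _; apply=> J [_]; apply; exists i => //=.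
  by rewrite finset.in_setC.
move=> f If; apply: mem_mpoly_ideal => u fu.
pose F := [set i | u i != 0%N]%SET.
have FD : F \notin Delta.
  apply/negP => DF; have [G mG sFG] := maxset_exists (P := mem Delta) DF.
  have [i] := (var_idealP _ _).1 (If G mG) u fu.
  rewrite finset.in_setC => /negP Gi ui; apply: Gi.
  by apply: (fintype.subsetP sFG); rewrite inE.
have -> : 'X_[u] = 'X_[k, u - \sum_(i in F) U_(i)] * \prod_(i in F) 'X_i :> S.
  rewrite mprodXE -mpolyXD submK //; apply/mnm_lepP => i.
  rewrite mnm_sumE; case: (boolP (i \in F)) => Fi.
    rewrite (bigD1 i) //= big1 ?mnm1E ?eqxx ?addn0 ?lt0n; first by rewrite inE in Fi.
    by move=> j /andP[_ /negbTE ji]; rewrite mnm1E ji.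
  rewrite big1 // => j Fj; rewrite mnm1E; case: eqP => // ji.
  by rewrite -ji Fj in Fi.
case: (idealP (stanley_reisner Delta)) => _ _; apply => J [_]; apply.
by exists F.
Qed.

(* The m-th symbolic power of [stanley_reisner Delta]; when Delta has no face
   the intersection is empty and gives the unit ideal. *)
Definition sr_symbolic_power Delta (m : nat) : ideal S :=
  ideal_bigcap (facet Delta) (fun G => ideal_pow (var_ideal (~: G)) m).

End Complexes.

(* Main.v *)
(* A monomial x^u lies outside I^(m) iff some basis B of the matroid has
   \sum_(i \notin B) u i < m.  Perturb the exponents u i to distinct weights;
   then u has a unique basis B of minimal weight off B, and by the exchange
   property optimality is a condition on pairs (i, j) with i in B and j outside B,
   bounding u i below in terms of u j.  Hence the vectors u with given optimal
   basis B and given exponents off B form a translate v + N^B.  These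
   translates partition the monomials outside I^(m), and the minimal weight
   is a monotone function of u that is constant on each of them and strictly
   increases when one leaves a translate upwards.  So adding the generators
   x^v to I^(m) by decreasing minimal weight gives a filtration with quotients
   S / P_([n] \ B), and these primes are exactly the minimal ones. *)
Require Import Defs.
From HB Require Import structures.
From mathcomp Require Import all_boot all_order all_algebra.
From mathcomp Require Import mpoly.

Set Implicit Arguments.
Unset Strict Implicit.
Unset Printing Implicit Defensive.

(** * Basis exchange and local optimality in a matroid *)

Section ExchangeStability.
Variables (n : nat) (Delta : {set {set 'I_n}}).
Hypothesis matD : matroid Delta.
Local Notation basis B := (maxset (mem Delta) B).
Implicit Types (F G H B : {set 'I_n}) (w : 'I_n -> nat).

(** Elements of [G] are added one at a time, by induction on the gap between the cardinalities. *)
Lemma matroid_augment F G : F \in Delta -> G \in Delta -> #|F| <= #|G| ->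
  exists2 H, H \in Delta & [/\ F \subset H, H \subset F :|: G & #|H| = #|G|].
Proof.
case: matD => _ augD FD GD.
have [d] := ubnP (#|G| - #|F|); elim: d F FD => // d IHd F FD.
move=> led; rewrite leq_eqVlt => /orP[/eqP eFG|ltFG].
  by exists F => //; rewrite eFG subxx subsetUl.
have [i /setDP[Gi Fi] iFD] := augD _ _ FD GD ltFG.
have ciF : #|i |: F| = #|F|.+1 by rewrite cardsU1 Fi.
have [||H HD [sFH sHF cH]] := IHd _ iFD; rewrite ?ciF //.
  by rewrite subnS; move: led; rewrite ltnS; case: (#|G| - #|F|) (subn_gt0 #|F| #|G|) => //; rewrite ltFG.
exists H => //; split=> //; first exact: subset_trans (subsetUr _ _) sFH.
by apply: subset_trans sHF _; rewrite !subUset sub1set inE Gi orbT subsetUl subsetUr.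
Qed.

Lemma card_le_basis F B : F \in Delta -> basis B -> #|F| <= #|B|.
Proof.
case: matD => _ augD FD /maxsetP[/= BD maxB]; rewrite leqNgt; apply/negP => ltBF.
have [i /setDP[_ Bi] iBD] := augD _ _ BD FD ltBF.
by case/negP: Bi; rewrite -(maxB _ iBD (subsetUr _ _)) setU11.
Qed.

Lemma basis_card F B : F \in Delta -> basis B -> #|B| <= #|F| -> basis F.
Proof.
move=> FD bB leBF; apply/maxsetP; split=> // G GD sFG.
by apply/esym/eqP; rewrite eqEcard sFG (leq_trans _ leBF) ?card_le_basis.
Qed.

(** Augmenting the face [e |: (B :&: B')] from [B] gives a set inside [e |: B] with [#|B|] elements,
    so exactly one [f] of [B] is dropped; it lies outside [B'] because [B :&: B'] is kept. *)
Lemma basis_exchange B B' e : basis B -> basis B' -> e \in B' :\: B ->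
  exists2 f, f \in B :\: B' & basis (e |: B :\ f).
Proof.
move=> bB bB' /setDP[B'e Be].
have [[BD _] [B'D _]] := (maxsetP bB, maxsetP bB').
have FD : e |: (B :&: B') \in Delta.
  by case: matD => sD _; apply: sD B'D _; rewrite subUset sub1set B'e subsetIr.
have [H HD [sFH sHF cH]] := matroid_augment FD BD (card_le_basis FD bB).
have He : e \in H by rewrite (subsetP sFH) // setU11.
have /subsetPn[f Bf Hf] : ~~ (B \subset H).
  by apply: contraNN Be => sBH; have /eqP-> : B == H by rewrite eqEcard sBH cH leqnn.
exists f.
  rewrite inE Bf andbT; apply: contraNN Hf => B'f.
  by rewrite (subsetP sFH) // !inE Bf B'f orbT.
have ef : e != f by apply: contraNneq Hf => <-.
suff <- : H = e |: B :\ f by apply: basis_card HD bB _; rewrite cH.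
apply/eqP; rewrite eqEcard cardsU1 !inE (negbTE Be) andbF cH [#|B|](cardsD1 f) Bf leqnn andbT.
apply/subsetP=> x Hx; have := subsetP sHF _ Hx; rewrite !inE.
case: (x =P e) => //= _; case: (x =P f) => [xf|_] /=; first by rewrite -xf Hx in Hf.
by rewrite orbC; case: (x \in B).
Qed.

(** The total weight being fixed, minimizing the weight off a basis maximizes the weight on it; the
    form off the basis is the one that measures membership in the symbolic power. *)
Definition cocost w B := \sum_(j | j \notin B) w j.

Lemma cocost_exchange w B i j : i \in B -> j \notin B ->
  cocost w (j |: B :\ i) + w j = cocost w B + w i.
Proof.
move=> Bi Bj; rewrite /cocost (bigD1 i) /=; last first.
  by rewrite !inE eqxx orbF; apply: contraNneq Bj => <-.
rewrite [X in _ = X + _](bigD1 j) //= addnC addnA [RHS]addnC addnA addnC [RHS]addnC.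
congr (_ + _); last exact: addnC.
apply: eq_bigl => x; rewrite !inE.
by case: (x =P i) => [->|_]; rewrite ?Bi ?andbF ?andbT //= orbC negb_or.
Qed.

Definition exchange_stable w B : Prop :=
  basis B /\ forall i j, i \in B -> j \notin B -> basis (j |: B :\ i) -> w j <= w i.

(** Take the heaviest [e] in the symmetric difference. Exchanging it into the basis that lacks it
    drops some [f] of that difference; stability gives [w e <= w f], so [e = f] by injectivity,
    which is absurd. *)
Lemma exchange_stable_inj w B B' : injective w ->
  exchange_stable w B -> exchange_stable w B' -> B = B'.
Proof.
move=> w_inj sB sB'; apply/eqP/negPn/negP => neqBB'.
pose D := (B :\: B') :|: (B' :\: B).
have [e0 De0] : exists e, e \in D.
  apply/set0Pn; apply: contraNneq neqBB' => D0.
  have /eqP := D0; rewrite setU_eq0 !setD_eq0 => /andP[sBB' sB'B].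
  by rewrite eqEsubset sBB'.
case: (arg_maxnP w De0) => e De maxe.
have noD A A' : exchange_stable w A -> exchange_stable w A' ->
    {subset A :\: A' <= D} -> e \notin A' :\: A.
  move=> [bA sA] [bA' _] sAD; apply/negP => A'e.
  have [f Af bf] := basis_exchange bA bA' A'e.
  have := maxe f (sAD f Af); have [[fA fA'] [eA' eA]] := (setDP Af, setDP A'e).
  rewrite /= => le_fe.
  have /w_inj ef : w e = w f by apply/eqP; rewrite eqn_leq le_fe sA.
  by rewrite ef fA in eA.
have {}De : e \in D by exact: De.
move: De; rewrite in_setU => /orP[]; apply/negP; apply: noD => // x Dx.
  by rewrite /D in_setU Dx orbT.
by rewrite /D in_setU Dx.
Qed.

Lemma min_cocost_stable w B : basis B ->
  (forall B', basis B' -> cocost w B <= cocost w B') -> exchange_stable w B.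
Proof.
move=> bB minB; split=> // i j Bi Bj bij.
by rewrite -(leq_add2l (cocost w B)) -(cocost_exchange w Bi Bj) leq_add2r minB.
Qed.

End ExchangeStability.

(** * Optimal bases and minimal costs of exponent vectors *)

Section OptimalBasis.
Variables (n : nat) (Delta : {set {set 'I_n}}).
Hypothesis matD : matroid Delta.
Local Notation basis B := (maxset (mem Delta) B).
Variable B0 : {set 'I_n}.
Hypothesis basis0 : basis B0.
Implicit Types (B : {set 'I_n}) (u v : 'X_{1..n}).

Definition max_weight_basis (w : 'I_n -> nat) : {set 'I_n} :=
  [arg min_(B < B0 | basis B) cocost w B].

Lemma max_weight_basisP w : basis (max_weight_basis w) /\
  forall B, basis B -> cocost w (max_weight_basis w) <= cocost w B.
Proof. by rewrite /max_weight_basis; case: arg_minnP. Qed.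

(** A global optimum is stable and stable bases are unique, so the pairwise test detects the
    optimum. *)
Lemma exchange_stable_max_weight w B : injective w ->
  exchange_stable Delta w B <-> max_weight_basis w = B.
Proof.
have [bw minw] := max_weight_basisP w; have st_w := min_cocost_stable bw minw.
by move=> w_inj; split=> [/(exchange_stable_inj matD w_inj st_w) //|<-].
Qed.

(** Large enough that the indices summed over a whole complement stay below one unit of exponent, as
    [mincost_geP] requires. *)
Definition tie_scale := (\sum_(i < n) i).+1.
Local Notation K := tie_scale.

Lemma ltn_tie_scale (i : 'I_n) : i < K.
Proof. by rewrite /tie_scale ltnS (bigD1 i) //= leq_addr. Qed.

(* Scaling the exponents and adding the index makes all weights distinct without
   reversing any strict inequality between exponents. *)
Definition tie_weight u (i : 'I_n) := K * u i + i.

(** The indices are below [K], so they decide only when the exponents tie. *)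
Lemma leq_tie_weight u v (i j : 'I_n) : i != j ->
  (tie_weight u j <= tie_weight v i) = (u j + (i < j) <= v i).
Proof.
move=> neq_ij; have [ltiK ltjK] := (ltn_tie_scale i, ltn_tie_scale j).
rewrite /tie_weight; case: (ltngtP i j) => ij /=; last 1 first.
- by rewrite (ord_inj ij) eqxx in neq_ij.
- rewrite addn1; apply/idP/idP => [|lt_uv].
    apply: contraTT; rewrite -leqNgt -ltnNge => le_vu.
    by rewrite -addnS leq_add ?leq_mul2l ?le_vu ?orbT.
  apply: leq_trans (leq_addr _ _); apply: leq_trans (leq_mul (leqnn K) lt_uv).
  by rewrite mulnS addnC leq_add2r ltnW.
- rewrite addn0; apply/idP/idP => [|le_uv].
    apply: contraTT; rewrite -!ltnNge => lt_vu.
    apply: leq_trans (leq_addr _ _); apply: leq_trans (leq_mul (leqnn K) lt_vu).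
    by rewrite mulnS addnC -addSn leq_add2r.
  by rewrite leq_add ?leq_mul2l ?le_uv ?orbT // ltnW.
Qed.

Lemma leq_tie_weight_same u v (i : 'I_n) :
  (tie_weight u i <= tie_weight v i) = (u i <= v i).
Proof. by rewrite leq_add2r leq_mul2l. Qed.

Lemma tie_weight_inj u : injective (tie_weight u).
Proof.
move=> i j /eqP; apply: contraTeq => neq_ij.
have neq_ji : j != i by rewrite eq_sym.
rewrite eqn_leq (leq_tie_weight _ _ neq_ij) (leq_tie_weight _ _ neq_ji).
case: (ltngtP i j) neq_ij => [||/ord_inj->]; last by rewrite eqxx.
  by move=> _ _; rewrite addn0 addn1 ltnNge andbN.
by move=> _ _; rewrite addn0 addn1 ltnNge andNb.
Qed.

Definition mbasis u := max_weight_basis (tie_weight u).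
Definition mincost u := cocost (tie_weight u) (mbasis u).

Lemma mbasis_basis u : basis (mbasis u).
Proof. by case: (max_weight_basisP (tie_weight u)). Qed.

Lemma mincost_min u B : basis B -> mincost u <= cocost (tie_weight u) B.
Proof. by case: (max_weight_basisP (tie_weight u)) => _; apply. Qed.

Lemma mbasis_stable u B : exchange_stable Delta (tie_weight u) B <-> mbasis u = B.
Proof. exact/exchange_stable_max_weight/tie_weight_inj. Qed.

Lemma cocost_tie_weight_leqif u v B : (u <= v)%MM ->
  cocost (tie_weight u) B <= cocost (tie_weight v) B
    ?= iff [forall (j | j \notin B), u j == v j].
Proof.
move/mnm_lepP=> le_uv; apply: leqif_sum => j _; split; first by rewrite leq_tie_weight_same.
by rewrite !eqn_leq !leq_tie_weight_same.
Qed.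

Lemma mincost_mono u v : (u <= v)%MM -> mincost u <= mincost v.
Proof.
move=> le_uv; apply: leq_trans (mincost_min u (mbasis_basis v)) _.
exact: cocost_tie_weight_leqif.
Qed.

(** Under [u], the optimal basis of [v] costs at least [mincost u] and at most [mincost v]. Equality
    makes it optimal for [u] as well and forces termwise equality off it. *)
Lemma mincost_eq u v : (u <= v)%MM -> mincost u = mincost v ->
  mbasis v = mbasis u /\ forall j, j \notin mbasis u -> v j = u j.
Proof.
move=> le_uv eq_c; have bv := mbasis_basis v.
have le1 := mincost_min u bv.
have [le2 eq2] := cocost_tie_weight_leqif (mbasis v) le_uv.
have eqB : mbasis u = mbasis v.
  apply/mbasis_stable/min_cocost_stable => // B bB.
  by apply: leq_trans le2 _; rewrite -[cocost _ _]/(mincost v) -eq_c mincost_min.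
rewrite eqB; split=> // j Bj; apply/esym/eqP.
move/esym: eq2; rewrite eqn_leq le2 -[cocost _ (mbasis v)]/(mincost v) -eq_c le1.
by move/forall_inP/(_ j Bj).
Qed.

(* The exponents off [B] decide how large those on [B] must be for [B] to be
   the optimal basis; hence [apex_of B u] is the least vector agreeing with [u] off
   [B] whose optimal basis is [B]. *)
Definition apex_of B u : 'X_{1..n} :=
  [multinom if i \in B then \max_(j | (j \notin B) && basis (j |: B :\ i)) (u j + (i < j))
            else u i | i < n].

Lemma apex_of_off B u j : j \notin B -> apex_of B u j = u j.
Proof. by move=> Bj; rewrite mnmE (negbTE Bj). Qed.

Lemma apex_of_ext B u v : (forall j, j \notin B -> u j = v j) -> apex_of B u = apex_of B v.
Proof.
move=> eq_uv; apply/mnmP => i; rewrite !mnmE; case: ifPn => [Bi|]; last exact: eq_uv.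
by apply: eq_bigr => j /andP[Bj _]; rewrite eq_uv.
Qed.

(** Stability of [B] amounts, pair by pair through [leq_tie_weight], to the lower bounds whose
    maxima define [apex_of] on [B]. *)
Lemma mbasis_apex_of B u : basis B -> mbasis u = B <-> (apex_of B u <= u)%MM.
Proof.
move=> bB; rewrite -mbasis_stable; split=> [[_ sB]|/mnm_lepP le_au].
  apply/mnm_lepP => i; rewrite mnmE; case: ifPn => // Bi.
  apply/bigmax_leqP => j /andP[Bj bij]; rewrite -leq_tie_weight ?sB //.
  by apply: contraNneq Bj => <-.
split=> // i j Bi Bj bij; rewrite leq_tie_weight; last by apply: contraNneq Bj => <-.
apply: leq_trans (le_au i); rewrite mnmE Bi.
by apply: (bigmax_sup j); rewrite ?Bj.
Qed.

Lemma mbasis_apex_ofK B u : basis B -> mbasis (apex_of B u) = B.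
Proof.
move=> bB; apply/mbasis_apex_of => //.
by rewrite (@apex_of_ext _ _ u) ?lepm_refl // => j; apply: apex_of_off.
Qed.

(** The least vector of the translate containing [u]; it serves as the label of that translate. *)
Definition apex u := apex_of (mbasis u) u.

Lemma apex_le u : (apex u <= u)%MM.
Proof. by apply/mbasis_apex_of => //; apply: mbasis_basis. Qed.

Lemma mbasis_apex u : mbasis (apex u) = mbasis u.
Proof. exact/mbasis_apex_ofK/mbasis_basis. Qed.

Lemma apex_off u j : j \notin mbasis u -> apex u j = u j.
Proof. exact: apex_of_off. Qed.

Lemma apex_eq u v : mbasis u = mbasis v -> (forall j, j \notin mbasis u -> u j = v j) ->
  apex u = apex v.
Proof. by rewrite /apex => <- /apex_of_ext. Qed.

Lemma apexK u : apex (apex u) = apex u.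
Proof. by apply: apex_eq; rewrite mbasis_apex // => j; apply: apex_off. Qed.

Lemma mincost_apex u : mincost (apex u) = mincost u.
Proof.
rewrite /mincost mbasis_apex; apply: eq_bigr => j Bj.
by rewrite /tie_weight apex_off.
Qed.

(** Equal costs fix the optimal basis and the exponents off it, and these determine the apex.
    Contrapositively, leaving a translate upwards raises the cost. *)
Lemma apex_incr u v : (u <= v)%MM -> mincost v <= mincost u -> apex v = apex u.
Proof.
move=> le_uv le_c; have /(mincost_eq le_uv)[eqB eq_vu] : mincost u = mincost v.
  by apply/eqP; rewrite eqn_leq mincost_mono.
by apply: apex_eq; rewrite eqB.
Qed.

(** Raising exponents on the basis preserves the lower bounds in [apex_of], since these involve only
    exponents off it. *)
Lemma apex_add u v : (forall j, j \notin mbasis u -> v j = 0) -> apex (u + v)%MM = apex u.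
Proof.
move=> v0; have eq_uv j : j \notin mbasis u -> (u + v)%MM j = u j.
  by move=> Bj; rewrite mnmDE v0 ?addn0.
suff eqB : mbasis (u + v)%MM = mbasis u by apply: apex_eq; rewrite eqB.
apply/mbasis_apex_of; first exact: mbasis_basis.
rewrite (apex_of_ext eq_uv); apply: lepm_trans (apex_le u) _.
exact: lem_addr.
Qed.

(** Turns membership in the symbolic power into a bound on the cost: the index terms total less than
    [K], so they cannot affect a comparison with a multiple of [K]. *)
Lemma mincost_geP m u :
  K * m <= mincost u <-> (forall B, basis B -> m <= \sum_(i in ~: B) u i).
Proof.
have costE B : cocost (tie_weight u) B = K * (\sum_(i in ~: B) u i) + \sum_(i in ~: B) i.
  rewrite big_distrr -big_split /=; apply: eq_bigl => i.
  by rewrite in_setC.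
have tieK (B : {set 'I_n}) : \sum_(i in ~: B) i < K.
  rewrite /tie_scale ltnS [leqRHS](bigID (mem (~: B))) /=; exact: leq_addr.
split=> [le_m B bB|le_m]; last first.
  by rewrite /mincost costE; apply: leq_trans (leq_addr _ _); rewrite leq_mul2l le_m ?orbT ?mbasis_basis.
have := leq_trans le_m (mincost_min u bB); rewrite costE leqNgt; apply: contraNleq => lt_m.
by apply: leq_trans (leq_mul (leqnn K) lt_m); rewrite mulnS addnC -addSn leq_add2r.
Qed.

(** Off the basis the cost keeps each exponent below [m]; on it the defining maximum adds at most 1.
    Hence only finitely many apexes lie outside the symbolic power. *)
Lemma apex_bound m u i : mincost u < K * m -> apex u i <= m.
Proof.
move=> lt_m; have off j : j \notin mbasis u -> u j < m.
  move=> Bj; rewrite -(ltn_pmul2l (isT : 0 < K)); apply: leq_ltn_trans lt_m.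
  by rewrite /mincost /cocost (bigD1 j) //= -addnA leq_addr.
rewrite mnmE; case: ifPn => [Bi|/off/ltnW //].
apply/bigmax_leqP => j /andP[Bj _]; apply: leq_trans (off j Bj).
by rewrite -[leqRHS]addn1 leq_add2l leq_b1.
Qed.

(** * Finite enumeration of the translates outside the symbolic power *)

Variable m : nat.

(** The functions into ['I_m.+1] exhaust the box given by [apex_bound]; decreasing cost is the order
    in which the filtration adds generators. *)
Definition apexes : seq 'X_{1..n} :=
  sort (fun u v => mincost v <= mincost u)
    [seq u <- undup [seq [multinom nat_of_ord (f i) | i < n] | f : {ffun 'I_n -> 'I_m.+1}]
     | (apex u == u) && (mincost u < K * m)].

Lemma mem_apexes u : (u \in apexes) = (apex u == u) && (mincost u < K * m).
Proof.
rewrite mem_sort mem_filter mem_undup.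
apply: andb_idr => /andP[/eqP au lt_u].
apply/mapP; exists [ffun i => inord (u i)]; first exact: mem_enum.
apply/mnmP => i; rewrite mnmE ffunE inordK // ltnS -au; exact: apex_bound.
Qed.

Lemma apexes_uniq : uniq apexes.
Proof. by rewrite sort_uniq filter_uniq // undup_uniq. Qed.

Lemma apex_in_apexes u : mincost u < K * m -> apex u \in apexes.
Proof. by move=> lt_u; rewrite mem_apexes apexK eqxx mincost_apex. Qed.

Lemma index_apexes u v : u \in apexes -> v \in apexes -> mincost u < mincost v ->
  index v apexes < index u apexes.
Proof.
move=> su sv; rewrite ltnNge; apply: contraNltn => le_idx.
apply: (@sorted_leq_index _ (fun u v : 'X_{1..n} => mincost v <= mincost u) _ _ apexes) => //.
- by move=> v1 v2 v3 /= h1 h2; apply: leq_trans h2 h1.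
- by apply: sort_sorted => v1 v2; apply: leq_total.
Qed.

End OptimalBasis.

(* Imported only here because [classical_sets] shadows many [finset] lemmas. *)
From mathcomp Require Import boolp classical_sets.
Import GRing.Theory.

(** * Cyclic quotients of ideals *)

Section CyclicQuotient.
Local Open Scope ring_scope.
Local Open Scope quotient_scope.
Variable R : comNzRingType.

Lemma ideal_quot_eqP (A B : ideal R) (x y : ideal_module A) :
  \pi_(ideal_quot A B) x = \pi_(ideal_quot A B) y <-> (B : set R) (val x - val y).
Proof.
rewrite -[val x - val y]/(val (x - y)); split=> [/eqP|Bxy].
  by rewrite -(Quotient.idealrBE (@trace_pred R A B)) => /set_mem.
apply/eqP; rewrite -(Quotient.idealrBE (@trace_pred R A B)); exact: mem_set.
Qed.

(** The second hypothesis says that the class of [a] has annihilator [P], the third that it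
    generates; the isomorphism sends the class of [f * a] to the class of [f]. *)
Lemma ideal_quot_cyclic (A B P : ideal R) (a : R) :
  (A : set R) a -> (forall f, (B : set R) (f * a) <-> (P : set R) f) ->
  (forall x, (A : set R) x -> exists f, (B : set R) (x - f * a)) ->
  module_iso (ideal_quot A B) (ideal_quot (unit_ideal R) P).
Proof.
move=> Aa BaP genA; have [_ BD BM] := idealP B; have [_ _ AM] := idealP A.
have BN x : (B : set R) x -> (B : set R) (- x) by rewrite -mulN1r; apply: BM.
pose U := ideal_quot A B; pose V := ideal_quot (unit_ideal R) P.
pose mk (f : R) : ideal_module (unit_ideal R) :=
  exist (fun x : R^o => x \in ideal_pred (unit_ideal R)) f (mem_set I).
(* A choice of coefficient of [a]; [hE] shows that its class modulo [P] does not depend on the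
   choice. *)
pose g (x : ideal_module A) := sval (cid (genA (val x) (set_mem (valP x)))).
have gP x : (B : set R) (val x - g x * a) by rewrite /g; case: cid.
pose h (z : U) : V := \pi_V (mk (g (repr z))).
have hE (x : ideal_module A) f : (B : set R) (val x - f * a) -> h (\pi_U x) = \pi_V (mk f).
  move=> Bx; apply/ideal_quot_eqP/BaP; rewrite /= mulrBl.
  have /ideal_quot_eqP Bxy : \pi_U (repr (\pi_U x)) = \pi_U x by rewrite reprK.
  rewrite (_ : _ - _ = (val x - f * a) + (val (repr (\pi_U x)) - val x)
                      - (val (repr (\pi_U x)) - g (repr (\pi_U x)) * a)).
    by apply: (BD); [apply: (BD) | apply: BN; apply: gP].
  by rewrite opprB [RHS]addrC [X in _ = _ + X]addrC !subrKA.
have lin : linear h.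
  move=> c; elim/quotW => x; elim/quotW => y.
  rewrite (hE x _ (gP x)) (hE y _ (gP y)).
  have -> : c *: \pi_U x + \pi_U y = \pi_U (c *: x + y).
    by rewrite raddfD; congr (_ + _); apply: pi_scale.
  rewrite (hE _ (c * g x + g y)); last first.
    rewrite (_ : _ - _ = c * (val x - g x * a) + (val y - g y * a)).
      by apply: BD (gP y); apply: BM (gP x).
    by rewrite /= mulrBr mulrDl mulrA opprD addrACA.
  rewrite -[c *: \pi_V _]/(quot_scale c _) pi_scale -raddfD.
  by congr (\pi_V _); apply: val_inj.
pose hL := GRing.isLinear.Build R U V *:%R h lin.
pose hl : {linear U -> V} := HB.pack h hL.
exists hl.
pose toA (f : R) : ideal_module A :=
  exist (fun x : R^o => x \in ideal_pred A) (f * a : R) (mem_set (AM f a Aa)).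
exists (fun z : V => \pi_U (toA (val (repr z)))).
- elim/quotW => x; rewrite /= (hE x _ (gP x)).
  have /ideal_quot_eqP Pxy : \pi_V (repr (\pi_V (mk (g x)))) = \pi_V (mk (g x)) by rewrite reprK.
  apply/ideal_quot_eqP => /=; rewrite (_ : _ - _ =
    (val (repr (\pi_V (mk (g x)))) - g x) * a - (val x - g x * a)).
    by apply: (BD); [apply/BaP | apply: BN; apply: gP].
  by rewrite mulrBl opprB addrA subrK.
- move=> z; rewrite /= (hE _ (val (repr z))) /= ?subrr; last by case: (idealP B).
  by rewrite -[RHS]reprK; congr (\pi_V _); apply: val_inj.
Qed.

End CyclicQuotient.

(** * Membership in monomial ideals and in powers of variable ideals *)

Section MonomialIdeals.
Local Open Scope ring_scope.
Variables (k : fieldType) (n : nat).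
Local Notation S := {mpoly k[n]}.
Implicit Types (F G : {set 'I_n}) (u v : 'X_{1..n}) (f g : S).

Lemma monomial_idealP (J : ideal S) (P : classical_sets.set 'X_{1..n}) :
  (forall f, (J : classical_sets.set S) f <-> forall u, u \in msupp f -> P u) ->
  is_monomial_ideal J.
Proof.
move=> JP; exists P; apply/seteqP; split=> f.
  by move/JP => Pf; apply: mem_mpoly_ideal => u /Pf Pu I [_]; apply; exists u.
apply: smallest_sub; first exact: idealP.
by move=> _ [u Pu <-]; apply/JP => v; rewrite msuppX inE => /eqP->.
Qed.

Lemma mem_mpolyX (J : ideal S) (P : classical_sets.set 'X_{1..n}) u :
  (forall f, (J : classical_sets.set S) f <-> forall u, u \in msupp f -> P u) ->
  (J : classical_sets.set S) 'X_[u] <-> P u.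
Proof.
move=> ->; split=> [|Pu v]; first by apply; rewrite msuppX inE.
by rewrite msuppX inE => /eqP->.
Qed.

Lemma var_ideal_monomial F : is_monomial_ideal (var_ideal k F).
Proof. exact: monomial_idealP (var_idealP F). Qed.

Lemma var_idealX F u :
  (var_ideal k F : classical_sets.set S) 'X_[u] <-> exists2 i, i \in F & u i != 0%N.
Proof. exact: mem_mpolyX (var_idealP F). Qed.

Lemma sub_var_ideal F G :
  (var_ideal k F `<=` var_ideal k G)%classic <-> F \subset G.
Proof.
split=> [sFG|/fintype.subsetP sFG f /var_idealP Ff]; last first.
  by apply/var_idealP => u /Ff[i /sFG Gi ui]; exists i.
apply/fintype.subsetP => i Fi; have /sFG/var_idealX[j Gj] :
    (var_ideal k F : classical_sets.set S) 'X_i.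
  by apply/var_idealX; exists i; rewrite // mnm1E eqxx.
by rewrite mnm1E; case: (i =P j) => // ->.
Qed.

(* [var_ideal F] is the kernel of the substitution that kills the variables in [F]. *)
Lemma var_ideal_prime F : is_prime_ideal (var_ideal k F).
Proof.
pose lq := [tuple (if i \in F then 0 else 'X_i : S) | i < n].
have phiX u : 'X_[u] \mPo lq = if [exists i in F, u i != 0%N] then 0 else 'X_[u].
  rewrite comp_mpolyX; case: ifPn => [/exists_inP[i Fi ui]|/exists_inPn nF].
    by rewrite (bigD1 i) //= tnth_mktuple Fi expr0n (negbTE ui) mul0r.
  rewrite [RHS]mpolyXE_id; apply: eq_bigr => i _; rewrite tnth_mktuple.
  by case: ifP => // /nF; rewrite negbK => /eqP->; rewrite !expr0.
have kerP f : (var_ideal k F : classical_sets.set S) f <-> f \mPo lq = 0.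
  rewrite var_idealP comp_mpolyEX; split=> [Ff|phi0 u fu].
    rewrite big_seq big1 // => u /Ff[i Fi ui]; rewrite phiX.
    have -> : [exists j in F, u j != 0%N] by apply/exists_inP; exists i.
    by rewrite scaler0.
  apply/exists_inP; apply: contraT => nFu; move: phi0 => /(congr1 (mcoeff u)).
  rewrite raddf_sum mcoeff0 /= (bigD1_seq u) //= big1 ?addr0.
    by rewrite phiX (negbTE nFu) mcoeffZ mcoeffX eqxx mulr1 => /eqP; rewrite mcoeff_eq0 fu.
  move=> v neq_vu; rewrite mcoeffZ phiX; case: ifP => _; rewrite ?mcoeff0 ?mulr0 //.
  by rewrite mcoeffX (negbTE neq_vu) mulr0.
split; first exact: idealP.
  by move/kerP; rewrite comp_mpoly1 => /eqP; rewrite oner_eq0.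
move=> f g /kerP; rewrite rmorphM /= => /eqP; rewrite mulf_eq0.
by case/orP=> /eqP/kerP; [left | right].
Qed.

(** Used to split off from [x^u] a product of [m] variables of [F], a generator of the ideal power;
    the variables are picked greedily. *)
Lemma mnm_degree_split F m u : (m <= \sum_(i in F) u i)%N ->
  exists2 t : 'I_m -> 'I_n, forall j, t j \in F & (\sum_(j < m) U_(t j) <= u)%MM.
Proof.
elim: m => [|m IHm] le_mu.
  exists (fun j : 'I_0 => False_rect 'I_n (notF (ltn_ord j))); first by case.
  by apply/mnm_lepP => i; rewrite mnm_sumE big_ord0.
have [t tF tu] := IHm (ltnW le_mu).
(* If no variable of [F] were left over, the degree of [u] in [F] would be at most the number [m]
   already picked. *)
have [i Fi lt_tu] : exists2 i, i \in F & ((\sum_(j < m) U_(t j))%MM i < u i)%N.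
  apply/exists_inP; apply: contraLR le_mu => /exists_inPn nlt.
  rewrite -ltnNge ltnS (@leq_trans (\sum_(i in F) (\sum_(j < m) U_(t j))%MM i)) //.
    by apply: leq_sum => i /nlt; rewrite -leqNgt.
  under eq_bigr do rewrite mnm_sumE.
  rewrite exchange_big /= -[leqRHS]card_ord -sum1_card; apply: leq_sum => j _.
  rewrite (bigD1 (t j)) //= mnm1E eqxx big1 // => l /andP[_ ltj].
  by rewrite mnm1E eq_sym (negbTE ltj).
exists (fun j => if unlift ord_max j is Some j' then t j' else i).
  by move=> j; case: unliftP.
rewrite big_ord_recr /= unlift_none; under eq_bigr => j _.
  rewrite (_ : widen_ord _ j = lift ord_max j) ?liftK; last first.
    by apply: val_inj; rewrite /= /bump leqNgt ltn_ord.
  over.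
apply/mnm_lepP => l; rewrite mnmDE mnm1E; case: (i =P l) => [<-|_].
  by rewrite addn1.
by rewrite addn0; apply: (mnm_lepP tu).
Qed.

Lemma ideal_pow_varP F m f : (ideal_pow (var_ideal k F) m : classical_sets.set S) f <->
  (forall u, u \in msupp f -> (m <= \sum_(i in F) u i)%N).
Proof.
split=> [|Ff]; last first.
  apply: mem_mpoly_ideal => u /Ff/mnm_degree_split[t tF tu].
  rewrite -(submK tu) mpolyXD -mprodXE.
  have [_ _] := idealP (ideal_pow (var_ideal k F) m); apply=> J [_]; apply.
  exists (fun j => 'X_(t j)) => // j; apply/var_idealX.
  by exists (t j); rewrite // mnm1E eqxx.
move: f; apply: smallest_sub.
  apply: (@msupp_div_ideal k n (fun u => (m <= \sum_(i in F) u i)%N)) => u v le_mu.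
  apply: leq_trans le_mu _; apply: leq_sum => i _; rewrite mnmDE; exact: leq_addr.
move=> _ [f Pf ->]; elim: m f Pf => [|m IHm] f Pf //= u.
rewrite big_ord_recr /= => /msuppM_le/allpairsP[[v w] /= [fv fw ->]].
under eq_bigr do rewrite mnmDE.
rewrite big_split /= -addn1 leq_add //; first exact: (IHm _ _ v fv).
have [i Fi wi] := (var_idealP _ _).1 (Pf ord_max) w fw.
by rewrite (bigD1 i) //= (leq_trans _ (leq_addr _ _)) // lt0n.
Qed.

(** * Minimal primes of the symbolic power *)

Variable Delta : {set {set 'I_n}}.

Lemma sr_symbolic_powerP m f : (sr_symbolic_power k Delta m : classical_sets.set S) f <->
  (forall u, u \in msupp f -> forall G, facet Delta G -> (m <= \sum_(i in ~: G) u i)%N).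
Proof.
split=> [If u fu G bG|If G bG]; last by apply/ideal_pow_varP => u fu; apply: If.
exact: (ideal_pow_varP _ _ _).1 (If G bG) u fu.
Qed.

Lemma prime_prod (R : comNzRingType) (Q : classical_sets.set R) (T : finType) (P : pred T)
    (h : T -> R) :
  is_prime_ideal Q -> (forall i, P i -> ~ Q (h i)) -> ~ Q (\prod_(i | P i) h i).
Proof.
case=> _ Q1 Qp Qh; apply: (big_ind (fun x => ~ Q x)) => // x y Qx Qy /Qp[].
  exact: Qx.
exact: Qy.
Qed.

(** Otherwise each facet [G] has a variable outside both [G] and [Q]. The product over all facets of
    the [m]-th powers of these variables lies in the symbolic power but not in the prime [Q]. *)
Lemma prime_over_symbolic_power (Q : classical_sets.set S) m : is_prime_ideal Q ->
  (sr_symbolic_power k Delta m `<=` Q)%classic ->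
  exists2 G, facet Delta G & (var_ideal k (~: G) `<=` Q)%classic.
Proof.
move=> prQ IQ; apply: contrapT => noG; have [idQ Q1 _] := prQ.
have /choice[t tP] G : exists u, ~ Q 'X_[u] /\
    (facet Delta G -> (m <= \sum_(i in ~: G) u i)%N).
  (* Sets that are not facets receive the monomial 1, so that the product can run over all sets. *)
  have [bG|] := pselect (facet Delta G); last by exists 0%MM; rewrite mpolyX0.
  have [i GI Qi] : exists2 i, i \notin G & ~ Q 'X_i.
    apply: contrapT => nQ; apply: noG; exists G => //; apply: smallest_sub => //.
    move=> _ [i /= Gi <-]; apply: contrapT => Qi; apply: nQ; exists i => //.
    by rewrite -finset.in_setC.
  exists (U_(i) *+ m)%MM; split=> [|_].
    by rewrite -mpolyXn -[m in _ ^+ m]card_ord -prodr_const; apply: prime_prod.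
  by rewrite (bigD1 i) ?finset.in_setC //= mulmnE mnm1E eqxx mul1n leq_addr.
have : ~ Q (\prod_G 'X_[t G]) by apply: prime_prod => // G _; case: (tP G).
rewrite mprodXE; apply; apply: IQ; apply/sr_symbolic_powerP => u.
rewrite msuppX inE => /eqP-> G bG; case: (tP G) => _ /(_ bG) le_m.
apply: leq_trans le_m _; apply: leq_sum => i _; rewrite mnm_sumE (bigD1 G) //=.
exact: leq_addr.
Qed.

(** Every prime over the symbolic power contains the ideal of a facet complement, and these ideals
    are pairwise incomparable because facets are. Positivity of [m] puts the symbolic power inside
    each. *)
Lemma min_primes_symbolic_power m : (0 < m)%N ->
  min_primes (sr_symbolic_power k Delta m) =
    [set (var_ideal k (~: G) : classical_sets.set S) | G in facet Delta]%classic.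
Proof.
move=> m0; have subP G : facet Delta G ->
    (sr_symbolic_power k Delta m `<=` var_ideal k (~: G))%classic.
  move=> bG f /sr_symbolic_powerP If; apply/var_idealP => u fu.
  have := leq_trans m0 (If u fu G bG); rewrite lt0n sum_nat_eq0 negb_forall.
  by case/existsP=> i; rewrite negb_imply => /andP[]; exists i.
apply/seteqP; split=> Q /=.
  case=> prQ IQ minQ; have [G bG GQ] := prime_over_symbolic_power prQ IQ.
  exists G => //; apply: minQ => //; [exact: var_ideal_prime | exact: subP].
case=> G bG <-; split; [exact: var_ideal_prime | exact: subP |].
move=> Q' prQ' IQ' Q'G; have [H bH HQ'] := prime_over_symbolic_power prQ' IQ'.
have /sub_var_ideal : (var_ideal k (~: H) `<=` var_ideal k (~: G))%classic.
  exact: subset_trans Q'G.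
rewrite finset.setCS => sGH; apply/seteqP; split=> //.
by have /maxsetP[_ maxG] := bG; rewrite -{1}(maxG H) //; case/maxsetP: bH.
Qed.

End MonomialIdeals.

(** * The filtration by translates and its primes *)

Section CleanFiltration.
Local Open Scope ring_scope.
Variables (k : fieldType) (n : nat) (Delta : {set {set 'I_n}}).
Hypothesis matD : matroid Delta.
Variable B0 : {set 'I_n}.
Hypothesis basis0 : facet Delta B0.
Variable m : nat.
Local Notation S := {mpoly k[n]}.
Local Notation set := classical_sets.set.
Implicit Types (u v : 'X_{1..n}) (f : S) (i : nat).

Local Notation cost := (mincost Delta B0).
Local Notation apx := (apex Delta B0).
Local Notation bas := (mbasis Delta B0).
Local Notation apxs := (apexes Delta B0 m).
Local Notation bound := (tie_scale n * m)%N.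

(** For [u] below the bound, the second alternative says that its translate is among the first
    [i]. *)
Definition layer i : set 'X_{1..n} :=
  fun u => (bound <= cost u)%N \/ (index (apx u) apxs < i)%N.

(** A step upwards either stays in the same translate or raises the cost, and then it reaches an
    earlier translate or the symbolic power. *)
Lemma layer_up i u v : layer i u -> layer i (u + v)%MM.
Proof.
move=> Lu; have le_uv : (u <= u + v)%MM by apply: lem_addr.
have le_c := mincost_mono basis0 le_uv.
have [le_m|lt_m] := leqP bound (cost (u + v)%MM); [by left | right].
have lt_mu := leq_ltn_trans le_c lt_m.
case: Lu => [|lt_i]; first by rewrite leqNgt lt_mu.
have [le_c'|lt_c] := leqP (cost (u + v)%MM) (cost u).
  by rewrite (apex_incr matD basis0 le_uv le_c').
apply: ltn_trans lt_i; apply: index_apexes; rewrite ?apex_in_apexes //.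
by rewrite !mincost_apex.
Qed.

Definition layer_ideal i : ideal S := Ideal (msupp_div_ideal k (@layer_up i)).

Definition layer_prime i : ideal S := var_ideal k (~: bas (nth 0%MM apxs i)).

Lemma layer_idealP i f :
  (layer_ideal i : set S) f <-> forall u, u \in msupp f -> layer i u.
Proof. by []. Qed.

Lemma layer_ideal0 : layer_ideal 0 = sr_symbolic_power k Delta m :> set S.
Proof.
apply/seteqP; split=> f.
  move=> Lf; apply/sr_symbolic_powerP => u /Lf[|//].
  by move/(mincost_geP basis0).
move/sr_symbolic_powerP=> If u fu; left; apply/(mincost_geP basis0).
exact: If.
Qed.

Lemma layer_idealT : layer_ideal (size apxs) = [set: S]%classic :> set S.
Proof.
apply/seteqP; split=> // f _ u _.
have [|lt_m] := leqP bound (cost u); [by left | right].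
by rewrite index_mem apex_in_apexes.
Qed.

Lemma nth_apexesP i : (i < size apxs)%N ->
  [/\ apx (nth 0%MM apxs i) = nth 0%MM apxs i, (cost (nth 0%MM apxs i) < bound)%N
    & index (nth 0%MM apxs i) apxs = i].
Proof.
move=> lt_i; have := mem_nth 0%MM lt_i.
by rewrite mem_apexes // => /andP[/eqP ? ?]; rewrite index_uniq ?apexes_uniq.
Qed.

(** Computes the colon of the layer by the apex [v] at position [i]. A factor supported on the basis
    stays in the translate of [v], which is not yet in the layer; any other factor raises the cost
    and so lands in the layer. *)
Lemma layer_colon i u : (i < size apxs)%N ->
  layer i (u + nth 0%MM apxs i)%MM <->
  exists2 j, j \in ~: bas (nth 0%MM apxs i) & u j != 0%N.
Proof.
move=> lt_i; have [] := nth_apexesP lt_i; set v := nth _ _ _ => av lt_v iv.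
rewrite addmC; split=> [Luv|[j Bj uj]].
  apply: contrapT => nu; have eq_a : apx (v + u)%MM = v.
    rewrite -{2}av; apply: apex_add => // j Bj; apply/eqP/negPn/negP => uj.
    by apply: nu; exists j; rewrite ?finset.in_setC.
  case: Luv; last by rewrite eq_a iv ltnn.
  by rewrite -(mincost_apex matD basis0) eq_a leqNgt lt_v.
have [le_m|lt_m] := leqP bound (cost (v + u)%MM); [by left | right].
rewrite -[X in (_ < X)%N]iv; apply: index_apexes; rewrite ?apex_in_apexes ?mem_nth //.
have le_v : (v <= v + u)%MM by apply: lem_addr.
rewrite mincost_apex // ltn_neqAle mincost_mono // andbT; apply/eqP.
move/(mincost_eq matD basis0 le_v) => [_ /(_ j)].
rewrite finset.in_setC in Bj; move/(_ Bj)/eqP; rewrite mnmDE -[X in _ == X]addn0.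
by rewrite eqn_add2l (negbTE uj).
Qed.

(** The new monomials all belong to the translate of the apex at position [i], which is its least
    vector. *)
Lemma layer_step i u : (i < size apxs)%N -> layer i.+1 u -> ~ layer i u ->
  (nth 0%MM apxs i <= u)%MM.
Proof.
move=> lt_i Lu nLu; have [le_m|lt_m] := leqP bound (cost u); first by case: nLu; left.
case: Lu => [|]; first by rewrite leqNgt lt_m.
rewrite ltnS leq_eqVlt => /orP[/eqP<-|lt_u]; last by case: nLu; right.
by rewrite nth_index ?apex_in_apexes // apex_le.
Qed.

Lemma layer_ideal_cyclic i : (i < size apxs)%N ->
  module_iso (ideal_quot (layer_ideal i.+1) (layer_ideal i))
             (ideal_quot (unit_ideal S) (layer_prime i)).
Proof.
move=> lt_i; have [] := nth_apexesP lt_i; set v := nth _ _ _ => av lt_v iv.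
apply: (@ideal_quot_cyclic _ _ _ _ 'X_[v]).
- by move=> u; rewrite msuppX inE => /eqP->; right; rewrite av iv.
- move=> f; rewrite layer_idealP var_idealP; split=> Lf u fu.
    apply/layer_colon => //; apply: Lf.
    by rewrite (perm_mem (msuppMX _ _)); apply/mapP; exists u; rewrite // addmC.
  move: fu; rewrite (perm_mem (msuppMX _ _)) => /mapP[w fw ->].
  by rewrite addmC; apply/layer_colon => //; apply: Lf.
move=> f Lf; pose good u := (v <= u)%MM.
(* This divides by [x^v] the terms of [f] that it divides; the other terms already lie in layer [i]
   by [layer_step]. *)
exists (\sum_(u <- msupp f | good u) f@_u *: 'X_[u - v]).
rewrite {1}[f]mpolyE (bigID good) /= mulr_suml addrAC -sumrB.
rewrite big1 ?add0r => [|u good_u]; last by rewrite -scalerAl -mpolyXD submK ?subrr.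
rewrite -big_filter; apply: (ideal_sum (J := layer_ideal i)) => u; rewrite mem_filter => /andP[bad_u fu].
have [_ _ LM] := idealP (layer_ideal i); rewrite -mul_mpolyC; apply: LM => w.
rewrite msuppX inE => /eqP->; apply: contrapT => nLu.
by rewrite /good (layer_step lt_i (Lf u fu) nLu) in bad_u.
Qed.

Lemma layer_ideal_proper i : (i < size apxs)%N ->
  (layer_ideal i `<` layer_ideal i.+1)%classic.
Proof.
move=> lt_i; have [] := nth_apexesP lt_i; set v := nth _ _ _ => av lt_v iv.
split=> [f Lf u /Lf[|lt_u]|]; [by left | by right; apply: ltnW |].
have Lv : (layer_ideal i.+1 : set S) 'X_[v].
  by move=> w; rewrite msuppX inE => /eqP->; right; rewrite av iv.
move/(_ _ Lv v); rewrite msuppX inE eqxx /layer av iv ltnn leqNgt lt_v.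
by case.
Qed.

Lemma layer_filtration : prime_filtration (sr_symbolic_power k Delta m)
  (size apxs) layer_ideal layer_prime.
Proof.
split=> [||i _|i|i lt_i]; [exact: layer_ideal0 | exact: layer_idealT | |
  exact: layer_ideal_proper |].
  exact: monomial_idealP (layer_idealP i).
by split; [exact: var_ideal_monomial | exact: var_ideal_prime | exact: layer_ideal_cyclic].
Qed.

Lemma layer_primes : (0 < m)%N -> filtration_supp (size apxs) layer_prime =
  [set (var_ideal k (~: G) : set S) | G in facet Delta]%classic.
Proof.
move=> m0; apply/seteqP; split=> Q [].
  by move=> i _ <-; exists (bas (nth 0%MM apxs i)) => //; apply: mbasis_basis.
(* Zero exponents off [B] put this apex outside the symbolic power, as [m] is positive; so the prime
   of [B] does occur. *)
move=> B bB <-; pose u := apex_of Delta B 0%MM.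
have Bu : bas u = B by apply: mbasis_apex_ofK.
have lt_u : (cost u < bound)%N.
  rewrite ltnNge; apply/negP => /(mincost_geP basis0)/(_ B bB).
  rewrite big1 => [|j]; first by rewrite leqNgt m0.
  by rewrite finset.in_setC => Bj; rewrite apex_of_off // mnm0E.
exists (index (apx u) apxs); first by rewrite /= index_mem apex_in_apexes.
by rewrite /layer_prime nth_index ?apex_in_apexes // mbasis_apex // Bu.
Qed.

End CleanFiltration.

Theorem theorem2p1 (k : fieldType) (n : nat) (Delta : {set {set 'I_n}})
  (hDelta : matroid Delta) (m : nat) (hm : (1 <= m)%N) :
  clean (sr_symbolic_power k Delta m).
Proof.
rewrite /clean min_primes_symbolic_power //.
have [[B0 basis0]|nofacet] := pselect (exists B0, facet Delta B0).
  by exists (size (apexes Delta B0 m)), (layer_ideal k hDelta basis0 m), (layer_prime k Delta B0 m);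
    split; [exact: layer_filtration | exact: layer_primes].
(* Without facets the symbolic power is the whole ring: the filtration has length 0 and both sets of
   primes are empty. *)
have IT : sr_symbolic_power k Delta m = [set: {mpoly k[n]}]%classic :> classical_sets.set _.
  by apply/seteqP; split=> // f _ G bG; case: nofacet; exists G.
exists 0, (fun=> sr_symbolic_power k Delta m), (fun=> sr_symbolic_power k Delta m); split.
  by split=> // i _; apply: monomial_idealP (sr_symbolic_powerP _ _).
apply/seteqP; split=> Q []; first by [].
by move=> G bG; case: nofacet; exists G.
Qed.
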